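(* For all positive integers $d$, $n$, and $a$, \begin{align*} h_d^{(a+1)}(n) & \leq h_d^{(a)}(n), \\ h_{d+1}^{(a)}(n) & \leq h_d^{(a)}(n), \\ h_d^{(a)}(n) & \leq h_d^{(a)}(n+1), \end{align*} and for all positive integers $d$, $n$, and $a$ with $a < \frac{d+3}{2}$, \begin{align*} \ell_d^{(a)}(n) &\leq \ell_d^{(a)}(n+1), \\ \ell_{d+1}^{(a)}(n) &\leq \ell_d^{(a)}(n). \end{align*}
   Context: A partition $\pi$ is a finite nonempty nonincreasing sequence of positive integers, called its parts. Its perimeter is (largest part of $\pi$) $+$ (number of parts of $\pi$) $-\,1$. A partition is $d$-distinct if any two consecutive parts $\pi_i\ge \pi_{i+1}$ satisfy $\pi_i-\pi_{i+1}\geq d$. For positive integers $n,a,d$: - $h_d^{(a)}(n)$ is the number of partitions with perimeter $n$ whose parts are $d$-distinct and all $\geq a$; - $\ell_d^{(a)}(n)$ is the number of partitions with perimeter $n$ all of whose parts are congruent to $a$ or $-a$ modulo $d+3$ (so $\ell_{d+1}^{(a)}(n)$ uses the modulus $d+4$). *)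

(* Defs.v *)
From mathcomp Require Import all_boot all_order all_algebra.

Set Implicit Arguments.
Unset Strict Implicit.
Unset Printing Implicit Defensive.

Definition is_partition (s : seq nat) : bool :=
  [&& s != [::], sorted geq s & all (leq 1) s].

Definition perimeter (s : seq nat) : nat := (\max_(x <- s) x) + size s - 1.

Definition d_distinct (d : nat) (s : seq nat) : bool :=
  sorted (fun x y => d <= x - y) s.

Definition congr_pm (m a x : nat) : bool :=
  ((x%:Z == a%:Z %[mod m%:Z])%Z || (x%:Z == (- a%:Z)%R %[mod m%:Z])%Z).

(* A partition of perimeter n has at most n parts, each at most n, so it is the
   image of exactly one sequence in {bseq n of 'I_n.+1}; num_perimeterP below
   shows that no partition is missed or counted twice. *)
Definition num_perimeter (P : pred (seq nat)) (n : nat) : nat :=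
  #|[set t : {bseq n of 'I_n.+1} |
      let s := [seq val x | x <- t] in
      [&& is_partition s, perimeter s == n & P s]]|.

Lemma num_perimeterP (P : pred (seq nat)) (n : nat) :
  exists r : seq (seq nat),
    [/\ uniq r,
        forall s, (s \in r) = [&& is_partition s, perimeter s == n & P s] &
        size r = num_perimeter P n].
Proof.
rewrite /num_perimeter; set A := [set t | _].
exists [seq [seq val x | x <- (t : {bseq n of 'I_n.+1})] | t <- enum A]; split.
- rewrite map_inj_uniq ?enum_uniq // => t u /(inj_map val_inj).
  exact: val_inj.
- move=> s; apply/mapP/idP => [[t]|Hs].
    by rewrite mem_enum inE => /= Ht ->.
  have /and3P[/and3P[s0 _ _] /eqP per _] := Hs.
  have sz0 : 0 < size s by case: (s) s0.
  have max0 : 0 < \max_(x <- s) x.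
    case/and3P: Hs => /and3P[_ _ /allP pos] _ _.
    case: (s) s0 pos => // y s' _ pos; rewrite big_cons leq_max.
    by rewrite pos // mem_head.
  have szn : size s <= n by rewrite -per /perimeter -addnBAC // leq_addl.
  have len x : x \in s -> x < n.+1.
    move=> xs; rewrite ltnS -per /perimeter -addnBA //.
    by apply: leq_trans (leq_addr _ _); apply: leq_bigmax_seq.
  have valK : [seq val x | x <- [seq inord x : 'I_n.+1 | x <- s]] = s.
    rewrite -map_comp -[RHS]map_id; apply/eq_in_map => x /len xn /=.
    by rewrite inordK.
  have szt : size [seq inord x : 'I_n.+1 | x <- s] <= n by rewrite size_map.
  by exists (Bseq szt); rewrite ?mem_enum ?inE /= valK.
- by rewrite size_map -cardE.
Qed.

Definition h (d a n : nat) : nat :=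
  num_perimeter (fun s => d_distinct d s && all (leq a) s) n.

Definition ell (d a n : nat) : nat :=
  num_perimeter (all (congr_pm (d + 3) a)) n.

(* Main.v *)
Require Import Defs.
From mathcomp Require Import all_boot all_order all_algebra.
From mathcomp Require Import zify.

Set Implicit Arguments.
Unset Strict Implicit.
Unset Printing Implicit Defensive.

(** Each inequality comes from an injection between the two sets of partitions.
    The first two are inclusions; for monotonicity in [n], enlarge the largest
    part by 1 (for [h]) or repeat it once (for [ell]).  For the last one, the
    parts allowed modulo [m] are [a < m - a < m + a < 2m - a < ...]; replace each
    part allowed modulo [m + 1] by the allowed part modulo [m] with the same rank,
    and make up for the loss of perimeter by repeating the largest part.  The
    largest part of the image determines how many copies were added. *)

(** A left inverse [g] on the counted partitions makes [f] injective there, so duplicate-free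
    enumerations can be compared by size. *)
Lemma num_perimeter_can (P Q : pred (seq nat)) (n m : nat)
    (f g : seq nat -> seq nat) :
  (forall s, is_partition s -> perimeter s = n -> P s ->
     [/\ is_partition (f s), perimeter (f s) = m, Q (f s) & g (f s) = s]) ->
  num_perimeter P n <= num_perimeter Q m.
Proof.
move=> H.
have [r [r_uniq rE <-]] := num_perimeterP P n.
have [r' [r'_uniq r'E <-]] := num_perimeterP Q m.
have {}H s : s \in r -> f s \in r' /\ g (f s) = s.
  rewrite rE r'E => /and3P[ps /eqP pers Ps].
  by have [-> -> -> ->] := H s ps pers Ps; rewrite eqxx.
rewrite -(size_map f); apply: uniq_leq_size => [|_ /mapP[s /H[fs _] ->] //].
rewrite map_inj_in_uniq // => s t /H[_ gs] /H[_ gt] eq_f.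
by rewrite -gs eq_f gt.
Qed.

Lemma num_perimeter_sub (P Q : pred (seq nat)) (n : nat) :
  (forall s, P s -> Q s) -> num_perimeter P n <= num_perimeter Q n.
Proof. by move=> PQ; apply: (@num_perimeter_can _ _ _ _ id id) => s ? ? /PQ. Qed.

Lemma perimeter_cons (x : nat) (s : seq nat) :
  sorted geq (x :: s) -> perimeter (x :: s) = x + size s.
Proof.
rewrite /perimeter big_cons /= (path_sortedE (rev_trans leq_trans)).
case/andP=> /allP ge_x _.
rewrite (maxn_idPl _); first lia.
by apply/bigmax_leqP_seq => y /ge_x.
Qed.

Lemma h_leq_minpart (d a n : nat) : h d (a + 1) n <= h d a n.
Proof.
apply: num_perimeter_sub => s /andP[-> /=].
by apply: sub_all => x; lia.
Qed.

Lemma h_leq_gap (d a n : nat) : h (d + 1) a n <= h d a n.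
Proof.
apply: num_perimeter_sub => s /andP[dd ->]; rewrite andbT.
by apply: sub_sorted dd => x y; lia.
Qed.

Lemma h_leq_perimeter (d a n : nat) : h d a n <= h d a (n + 1).
Proof.
pose f s := if s is x :: t then x.+1 :: t else [::].
pose g s := if s is x :: t then x.-1 :: t else [::].
apply: (@num_perimeter_can _ _ _ _ f g) => -[//|x s] /and3P[_ srt pos] per.
rewrite (perimeter_cons srt) in per.
move=> /andP[dd mina]; rewrite /f /g.
have srt1 : sorted geq (x.+1 :: s).
  by case: (s) srt {per pos dd mina} => //= y t /andP[xy ->]; rewrite andbT; lia.
split=> //.
- by rewrite /is_partition srt1; case/andP: pos.
- by rewrite perimeter_cons // -per; lia.
(* Only the first gap changes, and it widens. *)
- apply/andP; split; last by move: mina => /= /andP[ax ->]; rewrite andbT; lia.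
  by case: (s) dd => //= y t /andP[xy ->]; rewrite andbT; lia.
Qed.

Lemma ell_leq_perimeter (d a n : nat) : ell d a n <= ell d a (n + 1).
Proof.
pose f s : seq nat := if s is x :: t then x :: x :: t else [::].
apply: (@num_perimeter_can _ _ _ _ f (@behead nat)) => -[//|x s] /and3P[_ srt pos] per.
rewrite (perimeter_cons srt) in per.
move=> cong; rewrite /f.
have srt1 : sorted geq [:: x, x & s] by rewrite /= leqnn.
split=> //.
- by rewrite /is_partition srt1; move: pos => /= /andP[-> ->].
- by rewrite perimeter_cons // -per /=; lia.
- by move: cong => /= /andP[-> ->].
Qed.

(** Moving [-a] to the other side turns the integer congruence into a divisibility between
    naturals. *)
Lemma congr_pmE (m a x : nat) :
  congr_pm m a x = (x == a %[mod m]) || (m %| x + a).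
Proof.
by rewrite /congr_pm [X in _ || X]eqz_mod_dvd !modz_nat eqz_nat GRing.opprK -PoszD dvdzE.
Qed.

Lemma congr_pmP (m a x : nat) : 0 < a -> a < m ->
  reflect (exists k, x = k * m + a \/ x = k.+1 * m - a) (congr_pm m a x).
Proof.
move=> a_gt0 a_lt_m; rewrite congr_pmE.
apply: (iffP orP) => [[/eqP xa|/dvdnP[[|k] xa]]|[k [->|->]]].
- by exists (x %/ m); left; rewrite {1}(divn_eq x m) xa modn_small.
(* A zero quotient would give [x + a = 0], against [0 < a]. *)
- by lia.
- by exists k; right; rewrite -xa addnK.
- by left; rewrite modnMDl.
- by right; rewrite subnK ?dvdn_mull //; nia.
Qed.

(* If [2a < m] and [x = k (m + 1) +- a] then [(x + a) %/ (m + 1) = k], so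
   [lower m a x = k m +- a]; [raise] is the inverse on such values. *)
Definition lower (m a x : nat) : nat := x - (x + a) %/ m.+1.
Definition raise (m a x : nat) : nat := x + (x + a) %/ m.

(** The quotient by [m.+1] grows by at most the increase of [x], so subtracting it cannot reverse
    the order. *)
Lemma leq_lower (m a x y : nat) : x <= y -> lower m a x <= lower m a y.
Proof.
move=> le_xy; rewrite /lower.
have -> : y + a = (y - x) + (x + a) by lia.
have : (y - x + (x + a)) %/ m.+1 <= (y - x) + (x + a) %/ m.+1.
  rewrite -divnMDl // leq_div2r //; nia.
lia.
Qed.

(** The bound on the quotient makes the truncated subtraction in [lower] lossless, which the
    perimeter count needs. *)
Lemma lower_congr_pm (m a x : nat) : 0 < a -> 2 * a < m ->
  congr_pm m.+1 a x ->
  [/\ congr_pm m a (lower m a x), 0 < lower m a x,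
      (x + a) %/ m.+1 <= x & raise m a (lower m a x) = x].
Proof.
move=> a_gt0 a_lt /congr_pmP[] //; first lia.
move=> k xE; rewrite /raise /lower.
have [q xaE lowE] : exists2 q, (x + a) %/ m.+1 = q & x - q = k * m + a /\ q = k
    \/ x - q = k.+1 * m - a /\ q = k.+1.
  case: xE => ->; [exists k; last by left; nia|exists k.+1; last by right; nia].
    by rewrite -addnA divnMDl // divn_small; lia.
  by rewrite subnK ?mulnK //; nia.
rewrite xaE; have qx : q <= x by nia.
split=> //.
- by apply/congr_pmP; [lia|lia|exists k; lia].
- by nia.
(* For [k * m + a], adding [a] leaves remainder [2 * a < m]; for [k.+1 * m - a] it gives an exact
   multiple. Either way the quotient by [m] is [q]. *)
- case: lowE => -[xqE qE]; rewrite xqE.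
    by rewrite -[_ + a + a]addnA divnMDl ?(@divn_small (a + a)); lia.
  by rewrite subnK ?mulnK; nia.
Qed.

Lemma path_nseq_cat (x n : nat) (s : seq nat) :
  path geq x s -> path geq x (nseq n x ++ s).
Proof. by move=> xs; elim: n => //= n ->; rewrite leqnn. Qed.

Lemma ell_leq_modulus (d a n : nat) : 0 < a -> 2 * a < d + 3 ->
  ell (d + 1) a n <= ell d a n.
Proof.
move=> a_gt0 a_lt; rewrite /ell; have -> : d + 1 + 3 = (d + 3).+1 by lia.
set m := d + 3 in a_lt *; set lo := lower m a.
pose f s := if s is x :: t
  then lo x :: nseq ((x + a) %/ m.+1) (lo x) ++ map lo t else [::].
pose g s := if s is y :: t
  then map (raise m a) (y :: drop ((y + a) %/ m) t) else [::].
apply: (@num_perimeter_can _ _ _ _ f g) => -[//|x s] /and3P[_ srt pos] per cong.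
rewrite (perimeter_cons srt) in per.
have lowP y : y \in x :: s -> _ :=
  fun ys => lower_congr_pm a_gt0 a_lt (allP cong y ys).
have [lox_cong lox_gt0 le_qx loxK] := lowP x (mem_head _ _).
have loP y : y \in f (x :: s) -> congr_pm m a y /\ 0 < y.
  rewrite inE mem_cat mem_nseq => /or3P[/eqP->|/andP[_ /eqP->]|/mapP[z zs ->]] //.
  by have [] := lowP z; rewrite // inE zs orbT.
have srt_f : sorted geq (f (x :: s)).
  apply: path_nseq_cat; rewrite path_map; apply: sub_path srt => y z.
  exact: leq_lower.
split.
- by rewrite /is_partition srt_f; apply/allP => y /loP[].
(* The largest part loses exactly as much as the number of copies added to the tail. *)
- rewrite perimeter_cons // size_cat size_nseq size_map -per /lo /lower; lia.
- by apply/allP => y /loP[].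
(* [raise] adds back exactly what [lower] subtracted, so [g] reads the number of copies to drop from
   [lo x] alone. *)
- have qE : (lo x + a) %/ m = (x + a) %/ m.+1.
    by move: loxK; rewrite /raise /lo /lower; lia.
  rewrite /f /g qE drop_size_cat ?size_nseq //= loxK -map_comp map_id_in //.
  by move=> y ys; have [] := lowP y; rewrite // inE ys orbT.
Qed.

Theorem proposition1p6 :
  (forall d n a : nat, 0 < d -> 0 < n -> 0 < a ->
     [/\ h d (a + 1) n <= h d a n,
         h (d + 1) a n <= h d a n &
         h d a n <= h d a (n + 1)]) /\
  (forall d n a : nat, 0 < d -> 0 < n -> 0 < a -> 2 * a < d + 3 ->
     ell d a n <= ell d a (n + 1) /\ ell (d + 1) a n <= ell d a n).
Proof.
split=> [d n a _ _ _|d n a _ _ a_gt0 a_lt]; split.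
- exact: h_leq_minpart.
- exact: h_leq_gap.
- exact: h_leq_perimeter.
- exact: ell_leq_perimeter.
- exact: ell_leq_modulus.
Qed.
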